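(* For an infinite metrizable space $X$ the following assertions are equivalent: (i) $X$ is a locally compact separable (metric) space; (ii) the free topological vector space $\mathbb{V}(X)$ is a non-Fréchet–Urysohn sequential space; (iii) $\mathbb{V}(X)$ is a $k$-space; (iv) $\mathbb{V}(X)$ is a $k_\omega$-space.
   Context: All vector spaces are over $\mathbb{R}$; all topological spaces are Tychonoff (so topological vector spaces are Hausdorff). The free topological vector space over a Tychonoff space $X$ is a topological vector space $\mathbb{V}(X)$ together with a continuous map $i:X\to\mathbb{V}(X)$ such that for every continuous map $f$ from $X$ to a topological vector space $E$ there is a unique continuous linear operator $\bar f:\mathbb{V}(X)\to E$ with $f=\bar f\circ i$. A (Hausdorff) space $Z$ is: Fréchet–Urysohn if whenever $x\in\overline{A}$, $A\subseteq Z$, some sequence in $A$ converges to $x$; sequential if every sequentially closed subset is closed; a $k$-space if $A\subseteq Z$ is closed whenever $A\cap K$ is closed in $K$ for every compact $K\subseteq Z$; a $k_\omega$-space if there is an increasing sequence $C_1\subseteq C_2\subseteq\cdots$ of compact subsets with $Z=\bigcup_n C_n$ such that $U\subseteq Z$ is open if and only if $U\cap C_n$ is open in $C_n$ for every $n$. *)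

(* Defs.v *)
From HB Require Import structures.
From mathcomp Require Import all_boot all_order all_algebra.
From mathcomp Require Import all_classical all_reals all_analysis.

Set Implicit Arguments.
Unset Strict Implicit.
Unset Printing Implicit Defensive.

Import Order.TTheory GRing.Theory Num.Theory.
Import numFieldNormedType.Exports.

Local Open Scope classical_set_scope.
Local Open Scope ring_scope.

Definition metrizable (R : realType) (X : topologicalType) : Prop :=
  exists d : X -> X -> R,
    [/\ forall x y, 0 <= d x y,
        forall x y, d x y = 0 <-> x = y,
        forall x y, d x y = d y x,
        forall x y z, d x z <= d x y + d y z &
        forall (x : X) (A : set X),
          nbhs x A <-> exists2 e : R, 0 < e & [set y | d x y < e] `<=` A].

Definition separable (X : topologicalType) : Prop :=
  exists2 S : set X, countable S & dense S.

(* [topologicalLmodType R] is a real topological vector space, without local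
   convexity (unlike [tvsType]) and without any separation axiom: the Hausdorff
   property has to be required of the free space and of every target space. *)
Definition is_free_tvs (R : realType) (X : topologicalType)
    (V : topologicalLmodType R) (i : X -> V) : Prop :=
  [/\ hausdorff_space V,
      continuous i &
      forall (E : topologicalLmodType R) (f : X -> E),
        hausdorff_space E -> continuous f ->
        exists! g : V -> E, [/\ linear g, continuous g & f = g \o i]].

Definition frechet_urysohn (Z : topologicalType) : Prop :=
  forall (A : set Z) (x : Z), closure A x ->
    exists2 u : nat -> Z, (forall n, A (u n)) & u @ \oo --> x.

Definition sequentially_closed (Z : topologicalType) (A : set Z) : Prop :=
  forall (u : nat -> Z) (x : Z), (forall n, A (u n)) -> u @ \oo --> x -> A x.

Definition sequential_space (Z : topologicalType) : Prop :=
  forall A : set Z, sequentially_closed A -> closed A.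

(* [subspace K] has the same carrier as [Z], with the points outside [K] made
   isolated; a subset of [K] is closed (open) in it iff it is relatively closed
   (open) in [K]. *)
Definition k_space (Z : topologicalType) : Prop :=
  forall A : set Z,
    (forall K : set Z, compact K -> closed (A `&` K : set (subspace K))) ->
    closed A.

Definition k_omega_space (Z : topologicalType) : Prop :=
  exists C : nat -> set Z,
    [/\ forall n, C n `<=` C n.+1,
        forall n, compact (C n),
        \bigcup_n C n = [set: Z] &
        forall U : set Z,
          open U <-> forall n, open (U `&` C n : set (subspace (C n)))].

(* Main.v *)
Require Import Defs.
From HB Require Import structures.
From mathcomp Require Import all_boot all_order all_algebra.
From mathcomp Require Import all_classical all_reals all_analysis.
From mathcomp Require Import lra.
From mathcomp Require wochoice.
Import numFieldNormedType.Exports.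
Local Open Scope classical_set_scope.
Local Open Scope ring_scope.

Set Implicit Arguments.
Unset Strict Implicit.
Unset Printing Implicit Defensive.

Import Order.TTheory GRing.Theory Num.Theory.

(** Proof idea.

    Sequential spaces and k_omega-spaces are k-spaces, so it suffices to
    recover local compactness and separability of X from the k-space property
    of V, and to derive from them that V is k_omega, sequential and not
    Frechet-Urysohn.

    From k-space to locally compact and separable.  If X fails to be
    separable or locally compact, there is a set A in V that is not closed,
    although its trace on every compact set is finite.  Traces are controlled
    by real functionals alone: an infinite trace would contain the elements of
    a sequence on which the extension to V of a suitable continuous function
    X -> R is unbounded ([compact_not_growing]), because a nonnegative
    continuous function can be made to grow as fast as wanted along any
    sequence without cluster point ([escaping_growth]).
    - If X is not separable, it contains an uncountable uniformly separated
      set, and A consists of the vectors (i a + i b) / (phi a b + 1) with a, b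
      in this set.  Here phi is a Sierpinski-type colouring, unbounded on the
      square of every uncountable set ([uncountable_coloring]).  Some
      integer N is such that i a / (N+1) lies in a given neighbourhood of 0
      for uncountably many a, and a pair of such points of colour at least N
      gives an element of A near 0.
    - If X is separable but not locally compact at x0, each ball of radius
      1/(n+1) around x0 contains a sequence x_(n,m), m in N, without cluster
      point, and A consists of the vectors
      i x_(n,m) - i x0 + i x_(0,n) / (m+1).

    From locally compact and separable to k_omega.  Let C_n be compact sets
    whose interiors cover X, let V_0 = 0 and
    V_(n+1) = V_n + V_n + [-1,1] i(C_n), a compact set.  On the union L of the
    V_n, the sets made of all finite sums w_0 + w_1 + ... with w_k in
    W_k and V_k, where the W_k are balanced neighbourhoods of 0 in V, are a
    base at 0 of a Hausdorff vector topology finer than that of V for which i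
    is still continuous.  By the universal property L = V and both topologies
    agree ([free_stages]).  Conversely, a set that is open in every V_n and
    contains 0 contains such a set of sums: the W_k are found one after the
    other because a compact subset of an open set stays inside it when
    slightly enlarged ([stagewise_open_nbhs0]).  So V is a k_omega-space.

    Each V_n is moreover a continuous image of a compact subset of a
    first-countable space, which makes V sequential ([free_sequential]).  It is
    not Frechet-Urysohn for the reason that makes the Arens space fail: 0 is
    adherent to the vectors
    i x_0 / (n+1) + (i x_1 + ... + i x_n) / (m+1), but a sequence of
    them converging to 0 would need n to grow, whereas the number of points
    supporting a vector is bounded on each V_n
    ([free_not_frechet_urysohn]). *)

(** * Metrizable spaces *)

Definition compatible_metric (R : realType) (X : topologicalType)
    (d : X -> X -> R) : Prop :=
  [/\ forall x y, 0 <= d x y,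
      forall x y, d x y = 0 <-> x = y,
      forall x y, d x y = d y x,
      forall x y z, d x z <= d x y + d y z &
      forall (x : X) (A : set X),
        nbhs x A <-> exists2 e : R, 0 < e & [set y | d x y < e] `<=` A].

(** The sequences without cluster point. *)
Definition escaping (X : topologicalType) (y : nat -> X) : Prop :=
  forall x : X, exists2 U, nbhs x U & finite_set (y @^-1` U).

Lemma finite_nat_bounded (A : set nat) :
  finite_set A -> exists N, forall n, A n -> (n < N)%N.
Proof.
move=> /finite_seqP[s ->]; exists (\max_(k <- s) k).+1 => n /= ns.
by rewrite ltnS; exact: leq_bigmax_seq.
Qed.

Lemma infinite_sequence (T : Type) (A : set T) :
  infinite_set A -> exists2 y : nat -> T, injective y & forall n, A (y n).
Proof.
elim/Ppointed: T => T in A *.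
  by move=> /infinite_setN0[x]; rewrite emptyE.
move=> /infiniteP/pcard_leP[y]; exists y; last first.
  by move=> n; exact: (@funS _ _ _ _ y).
by move=> m n; apply: (@inj _ _ _ y); rewrite inE.
Qed.

Lemma inv_natS_lt (R : realType) (e : R) :
  0 < e -> exists n : nat, n.+1%:R^-1 < e.
Proof. by move=> /ltr_add_invr[n]; rewrite add0r; exists n. Qed.

Lemma escaping_comp (X : topologicalType) (y : nat -> X) (s : nat -> nat) :
  injective s -> escaping y -> escaping (y \o s).
Proof.
move=> s_inj y_esc x; have [U xU yU] := y_esc x; exists U => //.
by rewrite comp_preimage; apply: finite_preimage => // m n _ _; exact: s_inj.
Qed.

Section metric.
Variables (R : realType) (X : topologicalType) (d : X -> X -> R).
Hypothesis d_metric : compatible_metric d.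

Let d_ge0 x y : 0 <= d x y. Proof. by have [] := d_metric. Qed.
Let dC x y : d x y = d y x. Proof. by have [] := d_metric. Qed.
Let d_tri x y z : d x z <= d x y + d y z. Proof. by have [] := d_metric. Qed.
Let d_xx x : d x x = 0. Proof. by have [_ /(_ x x) []] := d_metric; auto. Qed.
Let d_gt0 x y : x != y -> 0 < d x y.
Proof.
move=> xy; rewrite lt_neqAle d_ge0 andbT eq_sym; apply: contraNneq xy => dxy.
by have [_ /(_ x y) [/(_ dxy) -> _]] := d_metric.
Qed.

Lemma nbhs_metricP x A :
  nbhs x A <-> exists2 e : R, 0 < e & [set y | d x y < e] `<=` A.
Proof. by have [] := d_metric. Qed.

Lemma nbhs_metric_ball x e : 0 < e -> nbhs x [set y | d x y < e].
Proof. by move=> e0; apply/nbhs_metricP; exists e. Qed.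

Lemma metric_continuous x : continuous (d x : X -> R^o).
Proof.
move=> y; apply/cvgrPdist_lt => e e0.
apply: filterS (nbhs_metric_ball y e0) => z /= dyz.
rewrite ltr_distl.
have := d_tri x y z; have := d_tri x z y; rewrite (dC z y).
by move=> ? ?; apply/andP; split; lra.
Qed.

Lemma open_metric_ball x e : open [set y | d x y < e].
Proof.
apply: (open_comp (f := (d x : X -> R^o)) (D := [set r | r < e])).
  by move=> y _; exact: metric_continuous.
exact: open_lt.
Qed.

Lemma closed_metric_ball x e : closed [set y | d x y <= e].
Proof.
apply: (closed_comp (f := (d x : X -> R^o)) (D := [set r | r <= e])).
  by move=> y _; exact: metric_continuous.
exact: closed_le.
Qed.

Lemma separating_function x (s : seq X) : x \notin s ->
  exists f : X -> R^o,
    [/\ continuous f, f x = 1 & forall y, y \in s -> f y = 0].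
Proof.
elim: s => [_|y s IH]; first by exists (fun=> 1); split => // z; exact: cvg_cst.
rewrite inE negb_or => /andP[xy /IH[f [f_cont fx1 fs0]]].
exists (fun z => f z * (d y z / d y x)); split.
- move=> z; apply: cvgM; first exact: f_cont.
  by apply: cvgM; [exact: metric_continuous|exact: cvg_cst].
- by rewrite fx1 mul1r divff// gt_eqF// d_gt0// eq_sym.
- move=> z; rewrite inE => /orP[/eqP->|/fs0->]; last by rewrite mul0r.
  by rewrite d_xx mul0r mulr0.
Qed.

(** Bumps of radius 1/(n+1) centred at the [y n] form a locally finite family:
    a bump that meets a small ball around [x] has its centre near [x] as soon
    as its radius is small. *)
Lemma escaping_growth (y : nat -> X) (c : nat -> R) : escaping y ->
  exists f : X -> R^o,
    [/\ continuous f, forall x, 0 <= f x & forall n, c n <= f (y n)].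
Proof.
move=> y_esc.
pose b n x : R^o := `|c n| * Num.max 0 (1 - n.+1%:R * d x (y n)).
have b_ge0 n x : 0 <= b n x by rewrite mulr_ge0// le_max lexx.
have b_cont n : continuous (b n).
  move=> x; apply: cvgM; first exact: cvg_cst.
  have dc z : (d z (y n) : R) = d (y n) z by rewrite dC.
  rewrite [X in X @ _](_ : _ = (cst (0 : R^o)) \max
     (fun z => 1 - n.+1%:R * d (y n) z : R^o)); last first.
    by apply/funext => z /=; rewrite dc.
  rewrite dc.
  apply: (@continuous_max _ _ (cst (0 : R^o))
    (fun z => 1 - n.+1%:R * d (y n) z : R^o) x).
    exact: cvg_cst.
  apply: cvgB; first exact: cvg_cst.
  by apply: cvgM; [exact: cvg_cst|exact: metric_continuous].
have locfin (x : X) :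
    exists N, \forall z \near x, forall n, (N <= n)%N -> b n z = 0.
  have [U /nbhs_metricP[e e0 eU] /finite_nat_bounded[N1 N1P]] := y_esc x.
  have [N2 N2e] := inv_natS_lt (divr_gt0 e0 (ltr0Sn _ 1)).
  exists (maxn N1 N2).
  apply: filterS (nbhs_metric_ball x (divr_gt0 e0 (ltr0Sn _ 1))) => z /= dxz n.
  rewrite geq_max => /andP[N1n N2n].
  have n0 : 0 < n.+1%:R :> R by [].
  have [dzy|dzy] := ltP (d z (y n)) (n.+1%:R^-1); last first.
    rewrite /b (_ : Num.max _ _ = 0) ?mulr0//; apply: max_l.
    by rewrite subr_le0 -ler_pdivrMl ?mulr1.
  suff /N1P : U (y n) by rewrite ltnNge N1n.
  apply: eU => /=; apply: le_lt_trans (d_tri _ z _) _.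
  rewrite (splitr e); apply: ltrD => //.
  apply: lt_trans dzy _; apply: le_lt_trans N2e.
  by rewrite lef_pV2 ?posrE// ler_nat.
(* [N x] bounds the indices that contribute near [x], and any larger bound
   gives the same finite sum. *)
have [N NP] := choice locfin.
have sumE z M N' : (forall n, (M <= n)%N -> b n z = 0) ->
    (forall n, (N' <= n)%N -> b n z = 0) ->
    \sum_(n < M) b n z = \sum_(n < N') b n z.
  wlog MN : M N' / (M <= N')%N => [wlg bM bN|bM _].
    by have [/wlg|/ltnW/wlg] := leqP M N'; [apply|move=> /(_ bN bM) ->].
  rewrite -(subnKC MN) big_split_ord/= [X in _ + X]big1 ?addr0// => n _.
  by rewrite bM// leq_addr.
exists (fun x => \sum_(n < N x) b n x); split.
- move=> x; rewrite /continuous_at.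
  have cvgN : \sum_(n < N x) b n z @[z --> x] --> (\sum_(n < N x) b n x : R^o).
    by apply: cvg_big => [|n _]; [exact: add_continuous|exact: b_cont].
  apply: cvg_trans cvgN; apply: near_eq_cvg.
  apply: filterS (NP x) => z bz.
  by apply: sumE => //; exact: nbhs_singleton (NP z).
- by move=> x; exact: sumr_ge0.
- move=> n; apply: le_trans (ler_norm _) _.
  have bn : b n (y n) = `|c n|.
    by rewrite /b d_xx mulr0 subr0 max_r ?mulr1// ler01.
  have [nN|Nn] := ltnP n (N (y n)).
    by rewrite (bigD1 (Ordinal nN))//= bn lerDl sumr_ge0.
  by rewrite -bn (nbhs_singleton (NP (y n)))// sumr_ge0.
Qed.

Lemma separated_escaping (D : set X) (e : R) (y : nat -> X) : 0 < e ->
  (forall a b, D a -> D b -> a != b -> e <= d a b) ->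
  injective y -> (forall n, D (y n)) -> escaping y.
Proof.
move=> e0 D_sep y_inj Dy x; exists [set z | d x z < e / 2].
  by apply: nbhs_metric_ball; rewrite divr_gt0.
have [[n /= xyn]|none] := pselect (exists n, d x (y n) < e / 2); last first.
  rewrite (_ : _ @^-1` _ = set0) ?finite_set0//.
  by apply/seteqP; split => // n /= xyn; apply: none; exists n.
apply: sub_finite_set (finite_set1 n) => m /= xym; apply/y_inj/eqP.
apply: contraT => /(D_sep _ _ (Dy m) (Dy n)).
rewrite leNgt => /negP[]; apply: le_lt_trans (d_tri _ x _) _.
by rewrite dC (splitr e) ltrD.
Qed.

(** The union over n of maximal 1/(n+1)-separated sets is dense. *)
Lemma nonseparable_separated : ~ separable X ->
  exists e (D : set X), [/\ 0 < e, ~ countable D &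
    forall a b, D a -> D b -> a != b -> e <= d a b].
Proof.
move=> X_nsep; apply: contrapT => noD; apply: X_nsep.
pose sep e (D : set X) := forall a b, D a -> D b -> a != b -> e <= d a b.
have maxD (n : nat) : exists D : set X,
    sep n.+1%:R^-1 D /\ forall B, D `<` B -> ~ sep n.+1%:R^-1 B.
  apply: (@Zorn_bigcup _ (sep n.+1%:R^-1)) => F Fsep Ftot a b [A FA Aa] [B FB Bb].
  have [AB|BA] := Ftot _ _ FA FB.
    by apply: (Fsep _ FB) => //; exact: AB.
  by apply: (Fsep _ FA) => //; exact: BA.
have [D /all_and2[Dsep Dmax]] := choice maxD.
exists (\bigcup_n D n).
  apply: bigcup_countable => // n _; apply: contrapT => Dn; apply: noD.
  by exists n.+1%:R^-1, (D n); split => //; exact: Dsep.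
move=> O [x Ox] oO.
have /nbhs_metricP[e e0 eO] : nbhs x O by apply: open_nbhs_nbhs.
have [n ne] := inv_natS_lt e0.
have [[y Dy xy]|far] := pselect (exists2 y, D n y & d x y < n.+1%:R^-1).
  exists y; split; last by exists n.
  by apply: eO => /=; exact: lt_trans ne.
exfalso; have xfar y : D n y -> n.+1%:R^-1 <= d x y.
  by move=> Dy; rewrite leNgt; apply/negP => xy; apply: far; exists y.
apply: (Dmax n (D n `|` [set x])).
  split; first by left.
  move=> /(_ x (or_intror erefl)) /xfar.
  by rewrite d_xx leNgt invr_gt0 ltr0Sn.
move=> a b [Da|->] [Db|->] ab.
- exact: Dsep.
- by rewrite dC; exact: xfar.
- exact: xfar.
- by rewrite eqxx in ab.
Qed.

(** A filter without cluster point on [B] produces a countable cover of [B] by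
    basic balls whose complements belong to the filter; a point chosen outside
    the first n balls, for each n, gives a sequence without cluster point. *)
Lemma separable_compact (B : set X) : separable X -> closed B ->
  (forall y : nat -> X, (forall n, B (y n)) -> ~ escaping y) -> compact B.
Proof.
move=> [S S_count S_dense] B_closed B_noesc F FF FB.
apply: contrapT => noclust.
pose O (p : X * nat) := [set y | d p.1 y < p.2.+1%:R^-1].
pose J := [set p : X * nat | S p.1 /\ F (~` O p)].
have J_cover x : B x -> exists2 p, J p & O p x.
  move=> Bx; have : ~ cluster F x by move=> Fx; apply: noclust; exists x.
  move=> /existsNP[A /existsNP[W /not_implyP[FA /not_implyP[xW AW]]]].
  have [e e0 eW] := (nbhs_metricP x W).1 xW.
  have [n ne] := inv_natS_lt (divr_gt0 e0 (ltr0Sn _ 1)).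
  have n0 : 0 < n.+1%:R^-1 :> R by rewrite invr_gt0.
  have [s [xs Ss]] : [set y | d x y < n.+1%:R^-1]° `&` S !=set0.
    apply: S_dense; last exact: open_interior.
    by exists x; exact: nbhs_metric_ball.
  have {}xs := interior_subset xs.
  exists (s, n) => /=; last by rewrite /O/= dC.
  split => //; apply: filterS FA => a Aa /= sa.
  apply: AW; exists a; split => //.
  apply: eW => /=; apply: le_lt_trans (d_tri x s a) _; rewrite (splitr e).
  by apply: ltrD; apply: lt_trans ne.
have J_count : countable J.
  apply: (sub_countable (subset_card_le (B := S `*` setT) _)).
    by move=> p [].
  exact: countableX.
have /countable_injP[g g_inj] := J_count.
pose H k := [set y | forall p, J p -> g p = k -> ~ O p y].
have FH k : F (H k).
  have [[p [Jp gp]]|none] := pselect (exists p, J p /\ g p = k).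
    apply: filterS Jp.2 => y Opy q Jq gq.
    by rewrite (g_inj q p) ?inE// gq.
  by apply: filterS filterT => y _ p Jp gp; case: none; exists p.
have FG n : F (B `&` [set y | forall k, (k <= n)%N -> H k y]).
  apply: filterI => //; elim: n => [|n IH].
    by apply: filterS (FH 0%N) => y H0 k; rewrite leqn0 => /eqP->.
  apply: filterS (filterI IH (FH n.+1)) => y [Hy Hn] k.
  by rewrite leq_eqVlt => /orP[/eqP->//|]; exact: Hy.
have [y Gy] := choice (fun n => filter_ex (FG n)).
apply: (B_noesc y) => [n|x]; first by have [] := Gy n.
have [Bx|nBx] := pselect (B x); last first.
  exists (~` B).
    by apply: open_nbhs_nbhs; split => //; exact: closed_openC.
  rewrite (_ : _ @^-1` _ = set0) ?finite_set0//.
  by apply/seteqP; split => // n; have [] := Gy n.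
have [p Jp Opx] := J_cover x Bx; exists (O p).
  by apply: open_nbhs_nbhs; split; [exact: open_metric_ball|].
apply: sub_finite_set (finite_II (g p)) => n /= Opyn.
by rewrite ltnNge; apply/negP => gpn; have [_ /(_ _ gpn p Jp erefl)] := Gy n.
Qed.

(** The compact sets are the compact balls among those with a centre in a
    countable dense set and a radius 1/(n+1), each augmented by the point
    [x0] so that none is empty. *)
Lemma compact_exhaustion (x0 : X) : locally_compact [set: X] -> separable X ->
  exists C : nat -> set X, [/\ forall n, compact (C n), forall n, C n x0 &
    forall x : X, exists n, nbhs x (C n)].
Proof.
move=> X_lc [S /countable_injP[g g_inj] S_dense].
pose Q (k : nat * nat) : set X := [set x | exists2 s, S s /\ g s = k.1 &
  d s x <= k.2.+1%:R^-1].
pose C n : set X := if unpickle n is Some k then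
  if `[< compact (Q k) >] then Q k `|` [set x0] else [set x0] else [set x0].
exists C; split => [n|n|x].
- rewrite /C; case: unpickle => [k|]; last exact: compact_set1.
  case: asboolP => [Qk|_]; last exact: compact_set1.
  by apply: compactU => //; exact: compact_set1.
- rewrite /C; case: unpickle => [k|] //.
  by case: asboolP => // Qk; right.
have [K xK [K_cpt K_closed]] := X_lc x I.
have {xK} : nbhs x K.
  by move: xK; rewrite withinE => -[W xW]; rewrite !setIT => ->.
move=> /nbhs_metricP[e e0 eK].
have [n ne] := inv_natS_lt (divr_gt0 e0 (ltr0Sn _ 1)).
have n0 : 0 < n.+1%:R^-1 :> R by rewrite invr_gt0.
have [s [xs Ss]] : [set y | d x y < n.+1%:R^-1] `&` S !=set0.
  by apply: S_dense; [exists x; rewrite /= d_xx|exact: open_metric_ball].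
have QE : Q (g s, n) = [set y | d s y <= n.+1%:R^-1].
  apply/seteqP; split => [y [t [St gt] ty] /=|y sy]; last by exists s.
  by rewrite (g_inj s t) ?inE.
exists (pickle (g s, n)); rewrite /C pickleK QE.
case: asboolP => [_|[]].
  apply: filterS (_ : nbhs x [set y | d s y < n.+1%:R^-1]).
    by move=> y /= /ltW; left.
  by apply: open_nbhs_nbhs; split; [exact: open_metric_ball|rewrite /= dC].
apply: (subclosed_compact _ K_cpt); first exact: closed_metric_ball.
move=> y sy; apply: eK => /=; apply: le_lt_trans (d_tri x s y) _.
by rewrite (splitr e); apply: ltrD; [exact: lt_trans ne|exact: le_lt_trans ne].
Qed.
End metric.

(** * Topological vector spaces *)

Definition balanced (R : realType) (E : lmodType R) (W : set E) : Prop :=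
  forall (t : R) v, `|t| <= 1 -> W v -> W (t *: v).

Section tvs.
Variables (R : realType) (V : topologicalLmodType R).
Implicit Types (U W : set V) (x v : V).

Lemma tvs_addP x y U : nbhs (x + y) U ->
  exists A B, [/\ nbhs x A, nbhs y B & forall a b, A a -> B b -> U (a + b)].
Proof.
move=> /(@add_continuous V (x, y))[[A B] [xA yB] AB].
by exists A, B; split => // a b Aa Bb; apply: (AB (a, b)).
Qed.

Lemma tvs_scaleP (t : R) v U : nbhs (t *: v) U ->
  exists e W, [/\ 0 < e, nbhs v W &
    forall s w, `|t - s| < e -> W w -> U (s *: w)].
Proof.
move=> /(@scale_continuous R V (t, v))[[A B] [/= /nbhs_ballP[e e0 eA] vB] AB].
exists e, B; split => // s w ts Bw.
by apply: (AB (s, w)); split => //; exact: eA.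
Qed.

Lemma nbhs_translate x v U : nbhs (x + v) U -> nbhs v [set w | U (x + w)].
Proof.
move=> /tvs_addP[A [B [xA vB AB]]]; apply: filterS vB => b Bb /=.
by apply: AB => //; exact: nbhs_singleton xA.
Qed.

Lemma nbhs_translate0 x U : nbhs 0 [set w | U (x + w)] <-> nbhs x U.
Proof.
split=> [|xU]; last by apply: nbhs_translate; rewrite addr0.
rewrite -(addNr x) => /nbhs_translate; apply: filterS => w /=.
by rewrite addNKr.
Qed.

Lemma nbhs_scale (t : R) U : nbhs 0 U -> nbhs 0 [set w : V | U (t *: w)].
Proof.
rewrite -{1}(scaler0 _ t) => /tvs_scaleP[e [W [e0 W0 H]]].
by apply: filterS W0 => w /= Ww; apply: H => //; rewrite subrr normr0.
Qed.

Lemma nbhs0_absorbing v U : nbhs 0 U ->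
  exists2 e : R, 0 < e & forall t, `|t| < e -> U (t *: v).
Proof.
rewrite -{1}(scale0r v) => /tvs_scaleP[e [W [e0 vW H]]]; exists e => // t te.
by apply: H; [rewrite sub0r normrN|exact: nbhs_singleton].
Qed.

Lemma nbhs0_balanced U : nbhs 0 U ->
  exists W, [/\ nbhs 0 W, balanced W & forall a b, W a -> W b -> U (a + b)].
Proof.
rewrite -{1}(addr0 (0 : V)) => /tvs_addP[A [B [A0 B0 AB]]].
have : nbhs (0 : V) (A `&` B) by exact: filterI.
rewrite -{1}(scale0r (0 : V)) => /tvs_scaleP[e [N [e0 N0 eN]]].
exists [set w | exists (t : R) v, [/\ `|t| < e, N v & w = t *: v]]; split.
- apply: filterS (nbhs_scale ((e / 2)^-1) N0) => w /= Nw.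
  exists (e / 2), ((e / 2)^-1 *: w); split => //.
    by rewrite gtr0_norm; lra.
  by rewrite scalerA divff ?scale1r// gt_eqF//; lra.
- move=> t _ t1 [s [v [se Nv ->]]]; exists (t * s), v; split => //.
    by rewrite normrM; apply: le_lt_trans se; rewrite ler_piMl.
  by rewrite scalerA.
- move=> _ _ [s [v [se Nv ->]]] [s' [v' [se' Nv' ->]]].
  apply: AB; first by apply: (eN _ _ _ Nv).1; rewrite sub0r normrN.
  by apply: (eN _ _ _ Nv').2; rewrite sub0r normrN.
Qed.

Lemma nbhs0_absorbing_nat v U : nbhs 0 U -> exists n : nat, U (n.+1%:R^-1 *: v).
Proof.
move=> /(nbhs0_absorbing v)[e e0 eU]; have [n ne] := inv_natS_lt e0; exists n.
by apply: eU; rewrite gtr0_norm ?invr_gt0.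
Qed.

(** The tool for contradicting the k-space property. *)
Lemma k_space_finite_traces (A : set V) : hausdorff_space V -> k_space V ->
  (forall K, compact K -> finite_set (A `&` K)) -> closed A.
Proof.
move=> V_T2 V_k A_fin; apply: V_k => K /A_fin AK_fin; apply: closed_subspaceW.
by move: AK_fin; apply: (iffLR accessible_finite_set_closed);
  exact: hausdorff_accessible.
Qed.

End tvs.

(** * Functionals on the free topological vector space *)

Section free_tvs.
Variables (R : realType) (X : topologicalType) (d : X -> X -> R).
Variables (V : topologicalLmodType R) (i : X -> V).
Hypotheses (d_metric : compatible_metric d) (V_free : is_free_tvs i).

Lemma extend_functional (f : X -> R^o) : continuous f ->
  exists g : {linear V -> R^o}, continuous g /\ forall x, g (i x) = f x.
Proof.
move=> f_cont; have [_ _ /(_ R^o f (@norm_hausdorff _ _) f_cont)] := V_free.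
move=> [g [[g_lin g_cont fE] _]].
pose G : {linear V -> R^o} := HB.pack g (GRing.isLinear.Build R V R^o _ g g_lin).
by exists G; split => // x; rewrite fE.
Qed.

(** Choosing a function with values at least n / a n at [y n] makes the
    extended functional unbounded on the [u n]. The term at [x0] leaves room
    for vectors built from differences [i x - i x0]. *)
Lemma compact_not_growing (K : set V) (x0 : X) (y : nat -> X) (u : nat -> V)
    (a : nat -> R) : compact K -> escaping y -> (forall n, K (u n)) ->
  (forall n, 0 < a n) ->
  (forall (g : {linear V -> R^o}) n, (forall x, 0 <= g (i x)) ->
     a n * g (i (y n)) - g (i x0) <= g (u n)) -> False.
Proof.
move=> K_cpt y_esc Ku a_gt0 gu.
have [f [f_cont f_ge0 fy]] :=
  escaping_growth d_metric (fun n => n%:R / a n) y_esc.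
have [g [g_cont gE]] := extend_functional f_cont.
have [M [_ MP]] : bounded_set (g @` K).
  by apply: compact_bounded; apply: continuous_compact => //;
     exact: continuous_subspaceT.
pose b := M + 1 + f x0.
have [n bn] : exists n : nat, b < n%:R.
  exists (Num.bound `|b|); apply: le_lt_trans (ler_norm _) _.
    exact: archi_boundP.
have : `|g (u n)| <= M + 1 by apply: MP; [rewrite ltrDl|exists (u n)].
apply/negP; rewrite -ltNge; apply: lt_le_trans (ler_norm _).
apply: lt_le_trans (gu g n _); last by move=> x; rewrite gE.
rewrite !gE ltrBrDr; apply: lt_le_trans bn _.
by rewrite mulrC -ler_pdivrMr.
Qed.

End free_tvs.

(** * Unbounded colourings of pairs of an uncountable set *)

(** [D0] is a copy of the first uncountable ordinal: in a well-order of the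
    type, either all initial segments of [D] are countable or the first
    uncountable one will do. *)
Lemma uncountable_ladder (T : choiceType) (D : set T) : ~ countable D ->
  exists (D0 : set T) (lt : T -> T -> Prop), [/\ D0 `<=` D, ~ countable D0,
    forall a b, [\/ lt a b, a = b | lt b a] &
    forall b, D0 b -> countable [set a | D0 a /\ lt a b]].
Proof.
move=> D_unc; have [le le_wo] := wochoice.well_ordering_principle T.
have pairP a b : exists2 z, [/\ z = a \/ z = b, le z a & le z b] &
    forall z', z' = a \/ z' = b -> le z' a -> le z' b -> z' = z.
  have [|z [[]]] := le_wo [pred z | (z == a) || (z == b)].
    by exists a; rewrite inE eqxx.
  rewrite inE => zab zmin zuniq; exists z.
    split; first by case/orP: zab => /eqP; [left|right].
      by apply: zmin; rewrite inE eqxx.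
    by apply: zmin; rewrite inE eqxx orbT.
  move=> z' z'ab za zb; apply/esym/zuniq; split.
    by rewrite inE; case: z'ab => ->; rewrite eqxx ?orbT.
  by move=> w; rewrite inE => /orP[]/eqP->.
have refl a : le a a by have [z [[->|->]]] := pairP a a.
have anti a b : le a b -> le b a -> a = b.
  move=> ab ba; have [z _ zP] := pairP a b.
  by rewrite (zP a (or_introl erefl))// (zP b (or_intror erefl)).
pose lt a b := le a b /\ a <> b.
have tri a b : [\/ lt a b, a = b | lt b a].
  have [->|/eqP ab] := eqVneq a b; first by constructor 2.
  have [z [[->|->]] za zb _] := pairP a b; first by constructor 1.
  by constructor 3; split => // /esym.
have [[b0 b0D]|allD] :=
    pselect (exists2 b, D b & ~ countable [set a | D a /\ lt a b]); last first.
  exists D, lt; split => // b Db; apply: contrapT => b_unc.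
  by apply: allD; exists b.
move=> b0_unc.
have [|z [[zbad zmin] _]] := le_wo
    [pred b | `[< D b /\ ~ countable [set a | D a /\ lt a b] >]].
  by exists b0; apply/asboolP; split.
have [Dz z_unc] := asboolW zbad.
exists [set a | D a /\ lt a z], lt; split => //; first by move=> a [].
move=> b [Db [bz bNz]]; apply: (@sub_countable _ _ _ [set a | D a /\ lt a b]).
  by apply: subset_card_le => a [[]].
apply: contrapT => b_unc; apply/bNz/anti => //.
by apply: zmin; apply/asboolP; split.
Qed.

Lemma countableU (T : Type) (A B : set T) :
  countable A -> countable B -> countable (A `|` B).
Proof.
move=> cA cB; rewrite -bigcup2E; apply: bigcup_countable => // k _.
by case: k => [|[|k]] //=; exact: countable0.
Qed.

(** The colouring numbers the predecessors of each [b] injectively. An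
    uncountable [S] has a sequence with a common strict upper bound [b] in [S],
    and the numbers that [b] gives to this sequence are unbounded. *)
Lemma uncountable_coloring (T : choiceType) (D : set T) : ~ countable D ->
  exists (D0 : set T) (phi : T -> T -> nat), [/\ D0 `<=` D, ~ countable D0 &
    forall S, S `<=` D0 -> ~ countable S ->
    forall n, exists a b, [/\ S a, S b & (n <= phi a b)%N]].
Proof.
move=> /uncountable_ladder[D0 [lt [D0D D0_unc tri seg]]].
have segP b : exists f : T -> nat, D0 b ->
    {in [set a | D0 a /\ lt a b] &, injective f}.
  have [Db|nDb] := pselect (D0 b); last by exists (fun=> 0%N).
  by have /countable_injP[f f_inj] := seg b Db; exists f.
have [f f_inj] := choice segP.
exists D0, (fun a b => f b a); split => // S SD0 S_unc n.
have /infinite_sequence[c c_inj Sc] : infinite_set S.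
  by move=> /finite_set_countable.
have [b Sb cb] : exists2 b, S b & forall k, lt (c k) b.
  apply: contrapT => nob; apply: S_unc.
  apply: (@sub_countable _ _ _
    (\bigcup_k ([set a | D0 a /\ lt a (c k)] `|` [set c k]))); last first.
    apply: bigcup_countable => // k _; apply: countableU.
      exact/seg/SD0.
    exact: countable1.
  apply: subset_card_le => b Sb; apply: contrapT => bc; apply: nob.
  exists b => // k; have [//|ckb|bck] := tri (c k) b.
    by case: bc; exists k => //; right.
  by case: bc; exists k => //; left; split => //; exact: SD0.
have Db := SD0 _ Sb.
have fc_inj : injective (f b \o c).
  move=> k l /= fkl; apply/c_inj/(f_inj b Db) => //; rewrite inE.
    by split; [exact/SD0|exact: cb].
  by split; [exact/SD0|exact: cb].
have [k nk] := injective_gtn fc_inj n.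
by exists (c k), b; split => //; exact: ltnW.
Qed.

(** * If the free topological vector space is a k-space *)

Section k_space_free_tvs.
Variables (R : realType) (X : topologicalType) (d : X -> X -> R).
Variables (V : topologicalLmodType R) (i : X -> V).
Hypotheses (d_metric : compatible_metric d) (V_free : is_free_tvs i).
Hypothesis V_k : k_space V.

Let V_T2 : hausdorff_space V. Proof. by have [] := V_free. Qed.
Let i_cont : continuous i. Proof. by have [] := V_free. Qed.

Lemma k_space_free_separable : separable X.
Proof.
apply: contrapT => /(nonseparable_separated d_metric)[e [D [e0 D_unc D_sep]]].
have [D0 [phi [D0D D0_unc phiP]]] := uncountable_coloring D_unc.
pose a (p : X * X) : R := (phi p.1 p.2).+1%:R^-1.
have a_gt0 p : 0 < a p by rewrite invr_gt0.
pose w (p : X * X) : V := a p *: (i p.1 + i p.2).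
pose A := [set w p | p in [set p | D0 p.1 /\ D0 p.2]].
have A_fin K : compact K -> finite_set (A `&` K).
  (* If infinitely many pairs are involved, their first or their second
     components form an infinite, hence escaping, sequence. *)
  move=> K_cpt; pose P := [set p | [/\ D0 p.1, D0 p.2 & K (w p)]].
  suff P_fin : finite_set P.
    apply: sub_finite_set (finite_image w P_fin).
    by move=> _ [[p [p1 p2] <-] Kw]; exists p.
  have no_inf (c : X * X -> X) : (forall p, c p = p.1 \/ c p = p.2) ->
      finite_set (c @` P).
    move=> cP; apply: contrapT => /infinite_sequence[y y_inj yP].
    have /choice[p pP] n : exists p, P p /\ c p = y n.
      by have [q] := yP n; exists q.
    have y_esc : escaping y.
      apply: (separated_escaping d_metric e0 D_sep y_inj) => n.
      have [[p1 p2 _] <-] := pP n; apply: D0D.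
      by case: (cP (p n)) => ->.
    apply: (compact_not_growing d_metric V_free (x0 := y 0%N) (u := w \o p)
      (a := a \o p) K_cpt y_esc).
    - by move=> n; have [[]] := pP n.
    - by move=> n; exact: a_gt0.
    - move=> g n g_ge0 /=; rewrite linearZ/= linearD/= lerBlDr.
      apply: ler_wpDr => //; rewrite ler_pM2l//.
      have [_ <-] := pP n.
      by case: (cP (p n)) => ->; rewrite ?lerDl ?lerDr.
  have fin1 := no_inf fst (fun=> or_introl erefl).
  have fin2 := no_inf snd (fun=> or_intror erefl).
  apply: sub_finite_set (finite_setX fin1 fin2) => p Pp.
  by split; exists p.
have A_closed := k_space_finite_traces V_T2 V_k A_fin.
have : closure A 0.
  move=> U /nbhs0_balanced[W [W0 W_bal WU]].
  have /choice[n nW] x : exists n : nat, W (n.+1%:R^-1 *: i x).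
    exact: nbhs0_absorbing_nat.
  (* Some N works for uncountably many points at once. *)
  have [N N_unc] : exists N, ~ countable [set x | D0 x /\ n x = N].
    apply: contrapT => noN; apply: D0_unc.
    apply: (@sub_countable _ _ _ (\bigcup_N [set x | D0 x /\ n x = N])).
      by apply: subset_card_le => x D0x; exists (n x).
    apply: bigcup_countable => // N _; apply: contrapT => N_unc.
    by apply: noN; exists N.
  have [x [y [[Dx nx] [Dy ny] Nxy]]] := phiP _ (fun x => @proj1 _ _) N_unc N.
  exists (w (x, y)); split; first by exists (x, y).
  have small z : n z = N -> W (a (x, y) *: i z).
    move=> nz; rewrite (_ : a _ = (a (x, y) * N.+1%:R) * N.+1%:R^-1); last first.
      by rewrite mulfK// pnatr_eq0.
    rewrite -scalerA; apply: W_bal; last by rewrite -nz.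
    rewrite ger0_norm ?mulr_ge0 ?(ltW (a_gt0 _))//.
    by rewrite ler_pdivrMl// mulr1 ler_nat.
  by rewrite /w scalerDr; apply: WU; exact: small.
move=> /A_closed[p _ wp0].
(* The functional equal to 1 on the image of [i] does not vanish at [w p]. *)
have [g [_ gE]] := extend_functional V_free (fun=> cvg_cst (1 : R^o)).
have /eqP := congr1 g wp0.
rewrite linearZ/= linearD/= linear0 !gE mulf_eq0 gt_eqF//=.
by rewrite gt_eqF// addr_gt0.
Qed.

(** The metric fan at a point without compact neighbourhood: the [x n m] tend
    to [x0] as n grows, uniformly in m, while for fixed n they escape. The
    perturbation by [i (x 0 n)] along an escaping sequence keeps compact sets
    from meeting infinitely many rows. *)
Lemma k_space_free_locally_compact : locally_compact [set: X].
Proof.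
have X_sep := k_space_free_separable.
move=> x0 _; apply: contrapT => x0_nlc.
have ballP (n : nat) : exists y : nat -> X,
    (forall m, d x0 (y m) <= n.+1%:R^-1) /\ escaping y.
  apply: contrapT => noy; apply: x0_nlc.
  exists [set y | d x0 y <= n.+1%:R^-1].
    rewrite withinET; apply/(nbhs_metricP d_metric).
    by exists n.+1%:R^-1; [rewrite invr_gt0|move=> y /ltW].
  have cl : closed [set y | d x0 y <= n.+1%:R^-1] by exact: closed_metric_ball.
  split => //; apply: (separable_compact d_metric) => // y yB y_esc.
  by apply: noy; exists y.
have [x /all_and2[x_ball x_esc]] := choice ballP.
pose a (m : nat) : R := m.+1%:R^-1.
have a_gt0 m : 0 < a m by rewrite invr_gt0.
pose w (p : nat * nat) : V := i (x p.1 p.2) - i x0 + a p.2 *: i (x 0%N p.1).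
have A_fin K : compact K -> finite_set (range w `&` K).
  move=> K_cpt; pose P := [set p | K (w p)].
  suff P_fin : finite_set P.
    apply: sub_finite_set (finite_image w P_fin).
    by move=> _ [[p _ <-] Kw]; exists p.
  have gw (g : {linear V -> R^o}) p :
      g (w p) = g (i (x p.1 p.2)) - g (i x0) + a p.2 * g (i (x 0%N p.1)).
    by rewrite linearD linearB linearZ.
  have fst_fin : finite_set (fst @` P).
    apply: contrapT => /infinite_sequence[n n_inj nP].
    have /choice[p pP] k : exists p, P p /\ p.1 = n k.
      by have [q] := nP k; exists q.
    apply: (compact_not_growing d_metric V_free (x0 := x0) (u := w \o p)
      (a := a \o snd \o p) K_cpt (escaping_comp n_inj (x_esc 0%N))).
    - by move=> k; have [] := pP k.
    - by move=> k; exact: a_gt0.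
    - move=> g k g_ge0; have [_ pn] := pP k.
      by rewrite /= gw pn addrAC lerD2r lerDr.
  have sec_fin n : finite_set [set m | P (n, m)].
    apply: contrapT => /infinite_sequence[m m_inj mP].
    apply: (compact_not_growing d_metric V_free (x0 := x0)
      (u := fun k => w (n, m k)) (a := fun=> 1) K_cpt (escaping_comp m_inj (x_esc n)) mP) => //.
    move=> g k g_ge0.
    by rewrite /= gw mul1r lerDl mulr_ge0// ltW.
  apply: sub_finite_set (finite_setXR fst_fin (fun n _ => sec_fin n)).
  by move=> -[n m] Pnm; split => //=; exists (n, m).
have A_closed := k_space_finite_traces V_T2 V_k A_fin.
have : closure (range w) 0.
  move=> U /nbhs0_balanced[W [W0 _ WU]].
  have /(nbhs_metricP d_metric)[e e0 eW] : nbhs x0 [set y | W (i y - i x0)].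
    have iW : nbhs (i x0) [set v | W (v - i x0)].
      apply/nbhs_translate0; apply: filterS W0 => v /=.
      by rewrite addrC addKr.
    exact: (i_cont iW).
  have [n ne] := inv_natS_lt e0.
  have [m Wm] := nbhs0_absorbing_nat (i (x 0%N n)) W0.
  exists (w (n, m)); split; first by exists (n, m).
  by apply: WU => //; apply: eW => /=; exact: le_lt_trans ne.
move=> /A_closed[p _ wp0].
(* The functional equal to 1 on the image of [i] does not vanish at [w p]. *)
have [g [_ gE]] := extend_functional V_free (fun=> cvg_cst (1 : R^o)).
have /eqP := congr1 g wp0.
rewrite linearD linearB linearZ linear0 !gE subrr add0r => /eqP.
by rewrite [X in X = _]mulr1 => /eqP; rewrite gt_eqF.
Qed.

End k_space_free_tvs.

(** * Vector topologies given by a base at the origin *)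

Record tvs_base (R : realType) (E : lmodType R) (B : set (set E)) : Prop := {
  base_neq0 : B !=set0;
  base_directed : forall A A', B A -> B A' ->
    exists2 A'', B A'' & A'' `<=` A `&` A';
  base_half : forall A, B A ->
    exists2 A', B A' & forall x y, A' x -> A' y -> A (x + y);
  base_balanced : forall A, B A -> balanced A;
  base_absorbing : forall A, B A -> forall x,
    exists2 e : R, 0 < e & forall t, `|t| < e -> A (t *: x) }.

(** A copy of [E], so that it carries the topology determined by the base even
    when [E] already has one. *)
Definition tvs_of_base (R : realType) (E : lmodType R) (B : set (set E))
  of tvs_base B : Type := E.

Section tvs_of_base.
Variables (R : realType) (E : lmodType R) (B : set (set E)) (b : tvs_base B).
Local Notation T := (tvs_of_base b).

HB.instance Definition _ := GRing.Lmodule.on T.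

Let base0 A : B A -> A 0.
Proof.
move=> BA; have [e e0 /(_ 0)] := base_absorbing b BA 0.
by rewrite scaler0 normr0; apply.
Qed.

Let base_double n A : B A ->
  exists2 A', B A' & forall x, A' x -> A (2 ^+ n *: x).
Proof.
elim: n A => [|n IH] A BA; first by exists A => // x; rewrite scale1r.
have [A1 BA1 A1P] := base_half b BA; have [A2 BA2 A2P] := IH _ BA1.
exists A2 => // x /A2P A1x.
by rewrite exprS mulrDl mul1r scalerDl; exact: A1P.
Qed.

Definition base_nbhs (x : T) : set_system T :=
  [set A | exists2 U, B U & forall u, U u -> A (x + u)].

HB.instance Definition _ := hasNbhs.Build T base_nbhs.

Lemma base_nbhs_filter (x : T) : ProperFilter (nbhs x).
Proof.
split; first by move=> [U BU] /(_ 0 (base0 BU)).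
split.
- by have [U BU] := base_neq0 b; exists U.
- move=> P Q [U BU UP] [U' BU' UQ].
  have [W BW WU] := base_directed b BU BU'.
  by exists W => // w /WU[Uw U'w]; split; [exact: UP|exact: UQ].
- by move=> P Q PQ [U BU UP]; exists U => // u /UP /PQ.
Qed.

Lemma base_nbhs_singleton (x : T) A : nbhs x A -> A x.
Proof. by move=> [U BU /(_ _ (base0 BU))]; rewrite addr0. Qed.

Lemma base_nbhs_nbhs (x : T) A : nbhs x A -> nbhs x (nbhs^~ A).
Proof.
move=> [U BU UA]; have [W BW WU] := base_half b BU.
exists W => // u Wu; exists W => // v Wv.
by rewrite -addrA; apply/UA/WU.
Qed.

HB.instance Definition _ := Nbhs_isNbhsTopological.Build T
  base_nbhs_filter base_nbhs_singleton base_nbhs_nbhs.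

Lemma base_add_continuous : continuous (fun x : T * T => x.1 + x.2).
Proof.
move=> [x y] A [U BU UA]; have [W BW WU] := base_half b BU.
exists ([set x + u | u in W], [set y + u | u in W]) => /=.
  by split; exists W => // u Wu; exists u.
move=> [_ _] [/= [u Wu <-] [v Wv <-]].
by rewrite addrACA; apply/UA/WU.
Qed.

HB.instance Definition _ :=
  PreTopologicalNmodule_isTopologicalNmodule.Build T base_add_continuous.

Lemma base_scale_continuous : continuous (fun z : R^o * T => z.1 *: z.2).
Proof.
move=> [t x] A [U BU UA]; have [W BW WU] := base_half b BU.
have [e e0 eW] := base_absorbing b BW x.
(* 2 ^+ n bounds the scalars near [t]. *)
pose n := Num.bound (`|t| + 1).
have tn s : `|t - s| < 1 -> `|s| <= 2 ^+ n.
  move=> ts; apply: (@le_trans _ _ (`|t| + 1)).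
    by have := ler_distD t 0 s; rewrite !sub0r !normrN => H; lra.
  by apply/ltW/upper_nthrootP.
have [W' BW' W'W] := base_double n BW.
exists ([set s | `|t - s| < Num.min e 1], [set x + u | u in W']) => /=.
  split; last by exists W' => // u Wu; exists u.
  by apply/nbhs_ballP; exists (Num.min e 1) => //=; rewrite lt_min e0 ltr01.
move=> [s _] [/= + [u W'u <-]]; rewrite lt_min => /andP[tse ts1].
have -> : s *: (x + u) = t *: x + ((s - t) *: x + s *: u).
  by rewrite scalerDr addrA -scalerDl (addrC t) subrK.
apply/UA/WU; first by apply: eW; rewrite distrC.
have -> : s *: u = (s / 2 ^+ n) *: (2 ^+ n *: u).
  by rewrite scalerA divfK// expf_eq0 pnatr_eq0 andbF.
apply: (base_balanced b BW); last exact: W'W.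
rewrite normrM normfV (ger0_norm (exprn_ge0 _ _))//.
by rewrite ler_pdivrMr ?mul1r ?tn// exprn_gt0.
Qed.

HB.instance Definition _ :=
  TopologicalNmodule_isTopologicalLmodule.Build R T base_scale_continuous.

Lemma nbhs_baseE (x : T) A :
  nbhs x A <-> exists2 U, B U & forall u, U u -> A (x + u).
Proof. by []. Qed.

End tvs_of_base.

(** * Stages of the span of a space *)

Section submodule.
Variables (R : realType) (V : lmodType R) (S : set V).

Definition submodule : Prop :=
  S 0 /\ forall (a : R) u v, S u -> S v -> S (a *: u + v).

Definition submodule_pred of submodule : {pred V} := fun v => `[< S v >].

Lemma submodule_pred_closed (S_sub : submodule) :
  submod_closed (submodule_pred S_sub).
Proof.
split; first by apply/asboolP; have [] := S_sub.
by move=> a u v /asboolP Su /asboolP Sv; apply/asboolP; apply S_sub.2.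
Qed.

HB.instance Definition _ (S_sub : submodule) :=
  GRing.isSubmodClosed.Build R V (submodule_pred S_sub)
    (submodule_pred_closed S_sub).

Definition submodule_of (S_sub : submodule) : Type :=
  {v : V | v \in submodule_pred S_sub}.

HB.instance Definition _ (S_sub : submodule) :=
  SubChoice.on (submodule_of S_sub).
HB.instance Definition _ (S_sub : submodule) :=
  [SubChoice_isSubLmodule of submodule_of S_sub by <:].

End submodule.

Section stages.
Variables (R : realType) (X : topologicalType) (V : topologicalLmodType R).
Variables (i : X -> V) (C : nat -> set X) (x0 : X).
Hypothesis C_x0 : forall n, C n x0.

(** A single map, so that the next stage is visibly a continuous image of a
    product. *)
Definition stage_sum (p : (V * V) * (R^o * X)) : V :=
  p.1.1 + p.1.2 + p.2.1 *: i p.2.2.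

(** The doubling in stage m.+1 makes the union of the stages closed under
    addition and, through powers of 2, under all scalars. *)
Fixpoint stage (n : nat) : set V :=
  if n is m.+1 then
    stage_sum @` ((stage m `*` stage m) `*` ([set t | `|t| <= 1] `*` C m))
  else [set 0].

Lemma stageSP m u v (t : R) c : stage m u -> stage m v -> `|t| <= 1 -> C m c ->
  stage m.+1 (u + v + t *: i c).
Proof. by move=> *; exists ((u, v), (t, c)). Qed.

Lemma stage_add m u v : stage m u -> stage m v -> stage m.+1 (u + v).
Proof.
move=> mu mv; rewrite -[u + v]addr0 -(scale0r (i x0)).
by apply: stageSP => //; rewrite normr0 ler01.
Qed.

Lemma stage0 n : stage n 0.
Proof. by elim: n => // n IH; rewrite -(addr0 0); exact: stage_add. Qed.

Lemma stage_le m n : (m <= n)%N -> stage m `<=` stage n.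
Proof.
move=> /subnK <-; elim: (n - m)%N => // k IH v /IH kv.
by rewrite addSn -(addr0 v); apply: stage_add => //; exact: stage0.
Qed.

Lemma stage_point m (t : R) c : `|t| <= 1 -> C m c -> stage m.+1 (t *: i c).
Proof.
move=> t1 cC; rewrite -[_ *: _]add0r -(addr0 0).
by apply: stageSP => //; exact: stage0.
Qed.

Lemma stage_balanced n : balanced (stage n).
Proof.
elim: n => [|n IH] s v s1; first by move=> ->; exact: scaler0.
move=> [[[a b] [t c]] [[/= na nb] [t1 nc]] <-]; rewrite /stage_sum/= !scalerDr.
rewrite scalerA; apply: stageSP => //; [exact: IH|exact: IH|].
by rewrite normrM mulr_ile1.
Qed.

Lemma stage_double n k v : stage n v -> stage (n + k) (2 ^+ k *: v).
Proof.
move=> nv; elim: k => [|k IH]; first by rewrite addn0 scale1r.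
by rewrite addnS exprS mulrDl mul1r scalerDl; exact: stage_add.
Qed.

Lemma stages_submodule : submodule (\bigcup_n stage n).
Proof.
split; first by exists 0%N.
move=> a u v [m _ mu] [n _ nv]; pose k := Num.bound `|a|.
exists (maxn (m + k) n).+1 => //; apply: stage_add.
  apply: (stage_le (leq_maxl _ _)).
  have -> : a *: u = (a / 2 ^+ k) *: (2 ^+ k *: u).
    by rewrite scalerA divfK// expf_eq0 pnatr_eq0 andbF.
  apply: stage_balanced; last exact: stage_double.
  rewrite normrM normfV (ger0_norm (exprn_ge0 _ _))//.
  rewrite ler_pdivrMr ?exprn_gt0// mul1r.
  exact/ltW/upper_nthrootP.
by apply: (stage_le (leq_maxr _ _)); exact: nv.
Qed.

Fixpoint partial_sums (W : nat -> set V) (n : nat) : set V :=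
  if n is m.+1 then
    [set u + v | u in partial_sums W m & v in W m `&` stage m]
  else [set 0].

(** The basic neighbourhoods of 0 of the finest vector topology on the span
    that induces on each stage a topology coarser than the given one. *)
Definition stage_nbhs (W : nat -> set V) : set V := \bigcup_n partial_sums W n.

Definition balanced_nbhs (W : nat -> set V) : Prop :=
  forall n, nbhs 0 (W n) /\ balanced (W n).

Section balanced_nbhs.
Variable W : nat -> set V.
Hypothesis W_nbhs : balanced_nbhs W.

Let W0 n : W n 0. Proof. by apply: nbhs_singleton; have [] := W_nbhs n. Qed.

Lemma partial_sums_le m n : (m <= n)%N ->
  partial_sums W m `<=` partial_sums W n.
Proof.
move=> /subnK <-; elim: (n - m)%N => // k IH v /IH kv.
exists v => //; exists 0; rewrite ?addr0//; split => //; exact: stage0.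
Qed.

Lemma partial_sums_balanced n : balanced (partial_sums W n).
Proof.
elim: n => [|n IH] t v t1 /=; first by move=> ->; exact: scaler0.
move=> [a na [b [Wb nb] <-]]; exists (t *: a); first exact: IH.
exists (t *: b); last by rewrite scalerDr.
by split; [have [_] := W_nbhs n; apply|exact: stage_balanced].
Qed.

Lemma stage_nbhs_stage n v : W n v -> stage n v -> stage_nbhs W v.
Proof.
move=> Wv nv; exists n.+1 => //; exists 0; last by exists v => //; rewrite add0r.
apply: (partial_sums_le (leq0n n)); exact: erefl.
Qed.

(** Two sums are added termwise, which moves the k-th terms to stage k.+1. *)
Lemma stage_nbhs_half (W' : nat -> set V) :
  (forall n u v, W' n u -> W' n v -> W n.+1 (u + v)) ->
  forall n u v, partial_sums W' n u -> partial_sums W' n v ->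
  partial_sums W n.+1 (u + v).
Proof.
move=> W'W; elim=> [|n IH] u v /=.
  move=> -> ->; exists 0 => //; exists 0; rewrite ?addr0//.
move=> [a na [b [Wb nb] <-]] [a' na' [b' [Wb' nb'] <-]].
exists (a + a'); first exact: IH.
exists (b + b'); last by rewrite addrACA.
by split; [exact: W'W|exact: stage_add].
Qed.

End balanced_nbhs.

Lemma balanced_nbhs_half (U : nat -> set V) : (forall n, nbhs 0 (U n)) ->
  exists2 W, balanced_nbhs W & forall n u v, W n u -> W n v -> U n (u + v).
Proof.
move=> U0; have /choice[W WP] n := nbhs0_balanced (U0 n).
by exists W => [n|n u v]; have [? ? ?] := WP n; [split|auto].
Qed.

(** The span is taken as a submodule because it is not yet known to be the
    whole space; absorption only holds for vectors of the span. *)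
Lemma stage_nbhs_base : tvs_base (E := submodule_of stages_submodule)
  [set val @^-1` stage_nbhs W | W in balanced_nbhs].
Proof.
split.
- exists (val @^-1` stage_nbhs (fun=> setT)), (fun=> setT) => // n.
  by split => //; exact: filterT.
- move=> _ _ [W W0 <-] [W' W'0 <-].
  pose W'' n := W n `&` W' n; exists (val @^-1` stage_nbhs W'').
    exists W'' => // n; have [? Wb] := W0 n; have [? W'b] := W'0 n.
    split; first exact: filterI.
    by move=> t v t1 [Wv W'v]; split; [exact: Wb|exact: W'b].
  move=> x [n _ nx]; split; exists n => //; elim: n (val x) nx => //= n IH.
    by move=> _ [u /IH nu [v [[Wv _] nv] <-]]; exists u => //; exists v.
  by move=> _ [u /IH nu [v [[_ Wv] nv] <-]]; exists u => //; exists v.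
- move=> _ [W W0 <-].
  have [W' W'0 W'W] := balanced_nbhs_half (fun n => (W0 n.+1).1).
  exists (val @^-1` stage_nbhs W'); first by exists W'.
  move=> x y [m _ mx] [n _ ny]; exists (maxn m n).+1 => //.
  rewrite raddfD; apply: (stage_nbhs_half W0 W'W).
    exact: (partial_sums_le W'0 (leq_maxl m n)).
  exact: (partial_sums_le W'0 (leq_maxr m n)).
- move=> _ [W W0 <-] t x t1 [n _ nx]; exists n => //.
  by rewrite linearZ; exact: partial_sums_balanced.
- move=> _ [W W0 <-] x.
  have /asboolP[n _ nx] := valP x.
  have [e e0 eW] := nbhs0_absorbing (val x) (W0 n).1.
  exists (Num.min e 1); first by rewrite lt_min e0 ltr01.
  move=> t; rewrite lt_min => /andP[te t1]; apply: (stage_nbhs_stage W0 (n := n)).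
    exact: eW.
  by apply: stage_balanced => //; exact: ltW.
Qed.

(** The new topology is finer: halving [U] repeatedly keeps all the partial
    sums in [U]. *)
Lemma stage_nbhs_small U : nbhs 0 U ->
  exists2 W, balanced_nbhs W & stage_nbhs W `<=` U.
Proof.
move=> U0.
have half A : exists B : set V, nbhs 0 A ->
    [/\ nbhs 0 B, balanced B & forall a b, B a -> B b -> A (a + b)].
  by have [/nbhs0_balanced[B BP]|] := pselect (nbhs 0 A); [exists B|exists A].
have [h hP] := choice half.
pose W n := iter n.+1 h U.
have itern0 n : nbhs 0 (iter n h U).
  by elim: n => //= n IH; have [] := hP _ IH.
exists W => [n|v [n _]]; first by have [] := hP _ (itern0 n).
suff add m u w : partial_sums W m u -> iter m h U w -> U (u + w).
  by move=> nv; rewrite -(addr0 v); apply: (add n) => //; exact: nbhs_singleton.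
elim: m u w => [|m IH] u w /=; first by move=> ->; rewrite add0r.
move=> [a ma [b [Wb _] <-]] Ww; rewrite -addrA; apply: IH => //.
by have [_ _] := hP _ (itern0 m); apply.
Qed.

End stages.

(** * The stages determine the topology *)

Section stage_topology.
Variables (R : realType) (X : topologicalType) (V : topologicalLmodType R).
Variables (i : X -> V) (C : nat -> set X) (x0 : X).
Hypothesis i_cont : continuous i.
Hypothesis C_x0 : forall n, C n x0.
Hypothesis C_compact : forall n, compact (C n).

Local Notation stage := (stage i C).
Local Notation stage_nbhs := (stage_nbhs i C).

Lemma stage_sum_continuous : continuous (stage_sum i).
Proof.
move=> [[a b] [t c]].
apply: (@continuous2_cvg _ V V V _ _ (fun p => p.1.1 + p.1.2)
  (fun p => p.2.1 *: i p.2.2) +%R (a + b) (t *: i c)).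
- exact: (@add_continuous V (a + b, t *: i c)).
- apply: (@continuous2_cvg _ V V V _ _ (fun p => p.1.1) (fun p => p.1.2) +%R a b).
  + exact: (@add_continuous V (a, b)).
  + by apply: (cvg_comp _ fst cvg_fst); exact: cvg_fst.
  + by apply: (cvg_comp _ snd cvg_fst); exact: cvg_snd.
- apply: (@continuous2_cvg _ R^o V V _ _ (fun p => p.2.1) (fun p => i p.2.2)
    *:%R t (i c)).
  + exact: (@scale_continuous R V (t, i c)).
  + by apply: (cvg_comp _ fst cvg_snd); exact: cvg_fst.
  + apply: (cvg_comp _ (fun q => i q.2) cvg_snd).
    by apply: (cvg_comp _ i cvg_snd); exact: i_cont.
Qed.

Lemma stage_compact n : compact (stage n).
Proof.
elim: n => [|n IH] /=; first exact: compact_set1.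
apply: continuous_compact.
  exact/continuous_subspaceT/stage_sum_continuous.
apply: compact_setX; first exact: compact_setX.
apply: compact_setX => //.
rewrite (_ : [set t | _] = [set` `[-1, 1 : R]]); first exact: segment_compact.
by apply/seteqP; split => t /=; rewrite in_itv/= ler_norml.
Qed.

Lemma compact_add (A B : set V) : compact A -> compact B ->
  compact [set a + b | a in A & b in B].
Proof.
move=> A_cpt B_cpt.
rewrite (_ : [set _ | _ in _ & _ in _] =
    (fun p : V * V => p.1 + p.2) @` (A `*` B)).
  apply: continuous_compact; last exact: compact_setX.
  exact/continuous_subspaceT/add_continuous.
apply/seteqP; split => [_ [a Aa [b Bb <-]]|_ [[a b] [/= Aa Bb] <-]].
  by exists (a, b).
by exists a => //; exists b.
Qed.

Definition stagewise_open (U : set V) : Prop :=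
  forall n, exists2 G, open G & G `&` stage n = U `&` stage n.

Lemma stagewise_open_translate U k v : stagewise_open U -> stage k v ->
  stagewise_open [set w | U (v + w)].
Proof.
move=> U_open kv n; have [G G_open GU] := U_open (maxn k n).+1.
exists [set w | G (v + w)].
  rewrite openE => w /= Gvw; apply: nbhs_translate.
  exact: open_nbhs_nbhs.
have vn w : stage n w -> stage (maxn k n).+1 (v + w).
  move=> nw; apply: (stage_add C_x0).
    exact: (stage_le C_x0 (leq_maxl k n)).
  exact: (stage_le C_x0 (leq_maxr k n)).
apply/seteqP; split => w /= [Hw nw]; split => //.
  suff [] : (U `&` stage (maxn k n).+1) (v + w) by [].
  by rewrite -GU; split => //; exact: vn.
suff [] : (G `&` stage (maxn k n).+1) (v + w) by [].
by rewrite GU; split => //; exact: vn.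
Qed.

Lemma closure_balanced (W : set V) w : nbhs 0 W -> balanced W -> closure W w ->
  exists a b, [/\ W a, W b & w = a + b].
Proof.
move=> W0 W_bal cW.
have [z [Wz Wzw]] : W `&` [set z | W (z - w)] !=set0.
  apply: cW; apply/nbhs_translate0; apply: filterS W0 => v /=.
  by rewrite addrC addKr.
exists z, (w - z); split => //; last by rewrite addrC subrK.
by rewrite -opprB -scaleN1r; apply: W_bal; rewrite ?normrN1.
Qed.

(** The closure of [W] is what makes the enlarged set compact again. *)
Lemma compact_enlargement (U S : set V) n : stagewise_open U -> compact S ->
  S `<=` stage n -> S `<=` U ->
  exists W, [/\ nbhs 0 W, balanced W &
    forall s w, S s -> closure W w -> stage n w -> U (s + w)].
Proof.
move=> U_open S_cpt Sn SU; have [G G_open GU] := U_open n.+1.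
have SG : S `<=` G.
  move=> s Ss; suff [] : (G `&` stage n.+1) s by [].
  by rewrite GU; split; [exact: SU|apply: (stage_le C_x0 (leqnSn n)); exact: Sn].
have /nbhs0_balanced[W [W0 W_bal WP]] :
    nbhs 0 [set w : V | forall s, S s -> G (s + w)].
  have /compact_near_coveringP S_cov := S_cpt.
  apply: (S_cov V (nbhs 0) (fun w s => G (s + w))) => s Ss.
  apply: (@add_continuous V (s, 0)); rewrite /= addr0.
  by apply: open_nbhs_nbhs; split => //; exact: SG.
exists W; split => // s w Ss /(closure_balanced W0 W_bal)[a [b [Wa Wb ->]]] nab.
suff [] : (U `&` stage n.+1) (s + (a + b)) by [].
rewrite -GU; split; first exact: WP.
by apply: (stage_add C_x0) => //; exact: Sn.
Qed.

(** Starting from 0 in [U], the compact sets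
    S (n+1) = S n + (closure (W n) in stage n) are kept inside [U] by
    choosing each [W n] after [S n]. *)
Lemma stagewise_open_nbhs0 U : stagewise_open U -> U 0 ->
  exists2 W, balanced_nbhs W & stage_nbhs W `<=` U.
Proof.
move=> U_open U0.
pose good n (S : set V) := [/\ compact S, S `<=` stage n & S `<=` U].
have step (n : nat) (S : set V) : exists W : set V, good n S ->
    [/\ nbhs 0 W, balanced W &
      forall s w, S s -> closure W w -> stage n w -> U (s + w)].
  have [[S_cpt Sn SU]|] := pselect (good n S); last by exists setT.
  by have [W WP] := compact_enlargement U_open S_cpt Sn SU; exists W.
have [h hP] := choice (fun p : nat * set V => step p.1 p.2).
pose fix S n := if n is m.+1
  then [set u + v | u in S m & v in stage m `&` closure (h (m, S m))]
  else [set 0].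
have S_good n : good n (S n).
  elim: n => [|n IH] /=.
    by split; [exact: compact_set1|move=> _ ->; exact: erefl|move=> _ ->].
  have [_ _ hU] := hP (n, S n) IH; have [S_cpt Sn SU] := IH.
  split.
  - apply: compact_add => //; apply: compact_closedI; first exact: stage_compact.
    exact: closed_closure.
  - move=> _ [u Su [v [nv _] <-]]; apply: (stage_add C_x0) => //; exact: Sn.
  - by move=> _ [u Su [v [nv hv] <-]]; exact: hU.
exists (fun n => h (n, S n)) => [n|v [n _]].
  by have [] := hP (n, S n) (S_good n).
suff : partial_sums i C (fun n => h (n, S n)) n `<=` S n.
  by have [_ _ SU] := S_good n => nS /nS /SU.
elim: n => [|n IH] //= _ [a /IH Sa [b [hb nb] <-]].
by exists a => //; exists b => //; split => //; exact: subset_closure.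
Qed.

Lemma stagewise_open_open U : \bigcup_n stage n = setT ->
  (forall W, balanced_nbhs W -> nbhs 0 (stage_nbhs W)) ->
  stagewise_open U -> open U.
Proof.
move=> stage_all stage_0 U_open; rewrite openE => v Uv.
have [k _ kv] : (\bigcup_n stage n) v by rewrite stage_all.
have Uv_open := stagewise_open_translate U_open kv.
have [|W W0 WU] := stagewise_open_nbhs0 Uv_open; first by rewrite /= addr0.
by apply/nbhs_translate0; apply: filterS WU (stage_0 W W0).
Qed.

End stage_topology.

(** * Stages of the free topological vector space *)

Section free_stages.
Variables (R : realType) (X : topologicalType) (V : topologicalLmodType R).
Variables (i : X -> V) (C : nat -> set X) (x0 : X).
Hypothesis V_free : is_free_tvs i.
Hypothesis C_x0 : forall n, C n x0.
Hypothesis C_nbhs : forall x : X, exists n, nbhs x (C n).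

Let V_T2 : hausdorff_space V. Proof. by have [] := V_free. Qed.
Let i_cont : continuous i. Proof. by have [] := V_free. Qed.

Let E : topologicalLmodType R := tvs_of_base (stage_nbhs_base i C_x0).
Let emb : {linear E -> V} :=
  (val : submodule_of (stages_submodule i C_x0) -> V).

Let stage_i n x : C n x -> stage i C n.+1 (i x).
Proof.
by move=> nx; rewrite -[i x]scale1r; apply: (stage_point _ C_x0); rewrite ?normr1.
Qed.

Let emb_continuous : continuous emb.
Proof.
move=> x A /nbhs_translate0/(stage_nbhs_small i C)[W W0 WA].
apply/nbhs_baseE; exists (val @^-1` stage_nbhs i C W); first by exists W.
move=> u Wu; change (A (emb (x + u))); rewrite raddfD; exact: WA.
Qed.

Let E_T2 : hausdorff_space E.
Proof.
move=> p q pq; apply/val_inj/V_T2 => A B pA qB.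
have [r [Ar Br]] := pq _ _ (emb_continuous pA) (emb_continuous qB).
by exists (emb r).
Qed.

Let i_mem x : i x \in submodule_pred (stages_submodule i C_x0).
Proof.
apply/asboolP; have [n nx] := C_nbhs x.
by exists n.+1 => //; apply: stage_i; exact: nbhs_singleton nx.
Qed.

Let j (x : X) : E :=
  exist _ (i x) (i_mem x) : submodule_of (stages_submodule i C_x0).

Let emb_j x : emb (j x) = i x. Proof. by []. Qed.

Let j_continuous : continuous j.
Proof.
move=> x A /nbhs_baseE[_ [W W0 <-] WA]; have [n nx] := C_nbhs x.
have iW : nbhs (i x) [set v | W n.+2 (v - i x)].
  apply/nbhs_translate0; apply: filterS (W0 n.+2).1 => v /=.
  by rewrite addrC addKr.
apply: filterS (filterI nx (i_cont iW)) => y [ny Wy] /=.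
rewrite -(subrKC (j x) (j y)); apply: WA.
change (stage_nbhs i C W (emb (j y - j x))).
have -> : emb (j y - j x) = i y - i x by rewrite raddfB.
apply: (stage_nbhs_stage C_x0 W0 Wy).
apply: (stage_add C_x0); first exact: stage_i.
rewrite -scaleN1r; apply: stage_balanced; first by rewrite normrN1.
by apply: stage_i; exact: nbhs_singleton nx.
Qed.

(** The universal property gives a continuous linear map [g] from V to the
    span with its new topology that extends [i]; composed with the inclusion it
    is the identity, by uniqueness. *)
Lemma free_stages : \bigcup_n stage i C n = setT /\
  forall W, balanced_nbhs W -> nbhs 0 (stage_nbhs i C W).
Proof.
have [_ _ V_univ] := V_free.
have [g [[g_lin g_cont jE] _]] := V_univ E j E_T2 j_continuous.
have [h [_ h_uniq]] := V_univ V i V_T2 i_cont.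
pose G : {linear V -> E} := HB.pack g (GRing.isLinear.Build R V E _ g g_lin).
have gK v : emb (g v) = v.
  have h_id : h = id by apply: h_uniq; split => // x; exact: cvg_id.
  have h_g : h = emb \o g.
    apply: h_uniq; split.
    - by move=> a u w /=; rewrite -[g]/(G : V -> E) !linearP.
    - move=> x; apply: continuous_comp; first exact: g_cont.
      exact: emb_continuous.
    - by apply/funext => x; rewrite -emb_j jE.
  exact: (congr1 (@^~ v) (etrans (esym h_g) h_id)).
split.
  apply/seteqP; split => // v _.
  by have /asboolP := valP (g v); rewrite -[val _]/(emb (g v)) gK.
move=> W W0.
have : nbhs (g 0) (emb @^-1` stage_nbhs i C W).
  rewrite -[g]/(G : V -> E) linear0; apply/nbhs_baseE.
  exists (val @^-1` stage_nbhs i C W); first by exists W.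
  by move=> u; rewrite add0r.
move=> gW.
have {}gW : nbhs 0 (g @^-1` (emb @^-1` stage_nbhs i C W)) := g_cont _ _ gW.
by apply: filterS gW => v /= gv; rewrite -(gK v).
Qed.
End free_stages.

(** * Sequentiality and the failure of the Frechet-Urysohn property *)

(** Whole tails are asked to be small, so that any choice of points in the
    [G n] converges to [x]. *)
Definition first_countable (T : topologicalType) : Prop :=
  forall x : T, exists2 G : nat -> set T, forall n, nbhs x (G n) &
    forall A, nbhs x A -> exists N, forall n, (N <= n)%N -> G n `<=` A.

Lemma first_countable_prod (S T : topologicalType) :
  first_countable S -> first_countable T -> first_countable (S * T)%type.
Proof.
move=> S_fc T_fc [x y]; have [G xG GP] := S_fc x; have [H yH HP] := T_fc y.
exists (fun n => G n `*` H n) => [n|A [[B D] [/= xB yD] BDA]].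
  by exists (G n, H n) => //; split; [exact: xG|exact: yH].
have [M MP] := GP _ xB; have [N NP] := HP _ yD.
exists (maxn M N) => n; rewrite geq_max => /andP[Mn Nn] [a b] [/= Ga Hb].
by apply: BDA; split; [exact: MP Ga|exact: NP Hb].
Qed.

Lemma first_countable_metric (R : realType) (T : topologicalType)
  (d : T -> T -> R) : compatible_metric d -> first_countable T.
Proof.
move=> d_metric x; exists (fun n => [set y | d x y < n.+1%:R^-1]).
  by move=> n; apply: (nbhs_metric_ball d_metric); rewrite invr_gt0.
move=> A /(nbhs_metricP d_metric)[e e0 eA]; have [N Ne] := inv_natS_lt e0.
exists N => n Nn y /= xy; apply: eA => /=.
apply: lt_trans xy _; apply: le_lt_trans Ne.
by rewrite lef_pV2 ?posrE// ler_nat.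
Qed.

Lemma compatible_metric_real (R : realType) :
  compatible_metric (fun x y : R^o => `|x - y| : R).
Proof.
split => [x y|x y|x y|x y z|x A].
- exact: normr_ge0.
- split; first by move=> /normr0_eq0/eqP; rewrite subr_eq0 => /eqP.
  by move=> ->; rewrite subrr normr0.
- exact: distrC.
- exact: ler_distD.
- exact: nbhs_ballP.
Qed.

Section sequential_stages.
Variables (R : realType) (X : topologicalType) (V : topologicalLmodType R).
Variables (i : X -> V) (C : nat -> set X).
Hypothesis X_fc : first_countable X.
Hypothesis i_cont : continuous i.
Hypothesis C_compact : forall n, compact (C n).

Lemma stage_first_countable_image n :
  exists (T : topologicalType) (K : set T) (h : T -> V),
    [/\ first_countable T, compact K, continuous h & stage i C n = h @` K].
Proof.
elim: n => [|n [T [K [h [T_fc K_cpt h_cont nK]]]]].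
  exists R^o, [set 0], (fun=> 0); split; first
    exact: (first_countable_metric (@compatible_metric_real R)).
  - exact: compact_set1.
  - by move=> x; exact: cvg_cst.
  - by rewrite image_set1.
exists ((T * T) * (R^o * X))%type,
  ((K `*` K) `*` ([set t | `|t| <= 1] `*` C n)),
  (fun p => stage_sum i ((h p.1.1, h p.1.2), p.2)); split.
- apply: first_countable_prod; first exact: first_countable_prod.
  apply: first_countable_prod => //.
  exact: (first_countable_metric (@compatible_metric_real R)).
- apply: compact_setX; first exact: compact_setX.
  apply: compact_setX => //.
  rewrite (_ : [set t | _] = [set` `[-1, 1 : R]]); first exact: segment_compact.
  by apply/seteqP; split => t /=; rewrite in_itv/= ler_norml.
- move=> [[a b] q].
  apply: (@continuous_comp _ _ _ (fun p : (T * T) * (R^o * X) =>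
    ((h p.1.1, h p.1.2), p.2)) (stage_sum i)); last exact: stage_sum_continuous.
  apply: (@cvg_pair _ _ _ _ (nbhs (h a, h b)) (nbhs q)) => /=; last exact: cvg_snd.
  apply: (@cvg_pair _ _ _ _ (nbhs (h a)) (nbhs (h b))) => /=.
    apply: (cvg_comp _ (fun q => h q.1) cvg_fst).
    by apply: (cvg_comp _ h cvg_fst); exact: h_cont.
  apply: (cvg_comp _ (fun q => h q.2) cvg_fst).
  by apply: (cvg_comp _ h cvg_snd); exact: h_cont.
- rewrite /= nK; apply/seteqP; split.
    move=> _ [[[_ _] q] [[/= [a Ka <-] [b Kb <-]] qC] <-].
    by exists ((a, b), q).
  move=> _ [[[a b] q] [[/= Ka Kb] qC] <-].
  by exists ((h a, h b), q) => //; split => //; split; [exists a|exists b].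
Qed.

(** Sequential closedness lifts to the first-countable preimage of the stage,
    where it means closedness. *)
Lemma sequentially_closed_stage (A : set V) n : sequentially_closed A ->
  compact (A `&` stage i C n).
Proof.
move=> A_sc.
have [T [K [h [T_fc K_cpt h_cont ->]]]] := stage_first_countable_image n.
pose B := K `&` (h @^-1` A).
have -> : A `&` h @` K = h @` B.
  apply/seteqP; split => [v [Av [z Kz zv]]|_ [z [Kz Az] <-]].
    by exists z => //; split => //; rewrite /preimage/= zv.
  by split => //; exists z.
apply: continuous_compact; first exact: continuous_subspaceT.
have -> : B = K `&` closure B.
  apply/seteqP; split=> [z Bz|z [Kz cB]].
    by split; [exact: Bz.1|exact: subset_closure].
  split => //; have [G zG GP] := T_fc z.
  have bex n' : exists b : T, (B `&` G n') b := cB _ (zG n').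
  have [b bP] := choice bex.
  apply: (A_sc (h \o b)); first by move=> k; have [[]] := bP k.
  apply: (cvg_comp b h); last exact: h_cont.
  move=> W /GP[N NW]; exists N => // k /= Nk.
  by apply: (NW k Nk); have [] := bP k.
by apply: compact_closedI => //; exact: closed_closure.
Qed.

End sequential_stages.

Section k_omega_free_tvs.
Variables (R : realType) (X : topologicalType) (d : X -> X -> R).
Variables (V : topologicalLmodType R) (i : X -> V).
Hypotheses (d_metric : compatible_metric d) (V_free : is_free_tvs i).
Variables (C : nat -> set X) (x0 : X).
Hypothesis C_x0 : forall n, C n x0.
Hypothesis C_compact : forall n, compact (C n).
Hypothesis C_nbhs : forall x : X, exists n, nbhs x (C n).

Let V_T2 : hausdorff_space V. Proof. by have [] := V_free. Qed.
Let i_cont : continuous i. Proof. by have [] := V_free. Qed.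

Let stagewise_open_is_open U : stagewise_open i C U -> open U.
Proof.
by have [? ?] := free_stages V_free C_x0 C_nbhs; exact: stagewise_open_open.
Qed.

Lemma stagewise_closed (A : set V) :
  (forall n, closed (A `&` stage i C n)) -> closed A.
Proof.
move=> A_closed; rewrite -openC; apply: stagewise_open_is_open => n.
exists (~` (A `&` stage i C n)); first exact: closed_openC.
apply/seteqP; split => v [nA nv]; split => //; first by move=> Av; exact: nA.
by move=> [].
Qed.

Lemma free_k_omega : k_omega_space V.
Proof.
exists (stage i C); split.
- by move=> n; exact: stage_le.
- exact: stage_compact.
- by have [] := free_stages V_free C_x0 C_nbhs.
- move=> U; split => [U_open n|U_open].
    by apply/open_subspaceP; exists U => //; rewrite -setIA setIid.
  apply: stagewise_open_is_open => n.
  have /open_subspaceP[G G_open GU] := U_open n.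
  by exists G => //; rewrite GU -setIA setIid.
Qed.

Lemma free_sequential : sequential_space V.
Proof.
move=> A A_sc; apply: stagewise_closed => n; apply: compact_closed => //.
apply: sequentially_closed_stage => //; exact: first_countable_metric d_metric.
Qed.

(** A dual way to say that [v] is a combination of the points of [s], which
    spares the linear independence of the image of [i]. *)
Definition supported_by (s : seq X) (v : V) : Prop :=
  forall g : {linear V -> R^o}, (forall y, y \in s -> g (i y) = 0) -> g v = 0.

Lemma stage_support n : exists N, forall v, stage i C n v ->
  exists2 s, (size s <= N)%N & supported_by s v.
Proof.
elim: n => [|n [N NP]].
  by exists 0%N => v ->; exists [::] => // g _; exact: linear0.
exists (N + N).+1 => _ [[[a b] [t c]] [[/= /NP[s sN sP] /NP[s' s'N s'P]] _] <-].
exists (c :: s ++ s'); first by rewrite /= size_cat ltnS leq_add.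
move=> g g0; rewrite /stage_sum/= !linearD linearZ/= sP ?s'P ?g0 ?mem_head//.
- by rewrite scaler0 !addr0.
- by move=> y ys; apply: g0; rewrite inE mem_cat ys !orbT.
- by move=> y ys; apply: g0; rewrite inE mem_cat ys !orbT.
Qed.

(** A sequence in [range w] tending to 0 would meet every stage in a finite
    set, so its range would be closed and miss 0. *)
Lemma free_not_frechet_urysohn :
  infinite_set [set: X] -> ~ frechet_urysohn V.
Proof.
move=> /infinite_sequence[x x_inj _] V_FU.
pose w (p : nat * nat) : V := p.1.+1%:R^-1 *: i (x 0%N) +
  p.2.+1%:R^-1 *: \sum_(j < p.1) i (x j.+1).
have gw (g : {linear V -> R^o}) p : g (w p) = p.1.+1%:R^-1 * g (i (x 0%N)) +
    p.2.+1%:R^-1 * \sum_(j < p.1) g (i (x j.+1)).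
  by rewrite linearD !linearZ linear_sum.
have w_closure : closure (range w) 0.
  move=> U /nbhs0_balanced[W [W0 _ WU]].
  have [n Wn] := nbhs0_absorbing_nat (i (x 0%N)) W0.
  have [m Wm] := nbhs0_absorbing_nat (\sum_(j < n) i (x j.+1)) W0.
  by exists (w (n, m)); split; [exists (n, m)|exact: WU].
have [v vw v0] := V_FU _ _ w_closure.
have /choice[p pv] k : exists p, w p = v k by have [p _] := vw k; exists p.
(* The coefficient (n+1)^-1 of [i (x 0)] tends to 0 along the sequence. *)
have small_support M : finite_set [set k | (p k).1 <= M]%N.
  have [|f [f_cont f0 fj]] :=
      separating_function d_metric (x := x 0%N)
        (s := [seq x j.+1 | j <- iota 0 M]).
    by apply/mapP => -[j _ /x_inj].
  have [g [g_cont gE]] := extend_functional V_free f_cont.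
  have gv : g (v k) @[k --> \oo] --> g 0.
    by apply: (cvg_comp v g v0); exact: g_cont.
  have M0 : 0 < M.+1%:R^-1 :> R by rewrite invr_gt0.
  have [K _ KP] := (cvgrPdist_lt _ _).1 gv _ M0.
  apply: sub_finite_set (finite_II K) => k /= kM.
  rewrite ltnNge; apply/negP => /KP /=.
  rewrite linear0 sub0r normrN -pv gw gE f0 mulr1 big1 => [|j _]; last first.
    rewrite gE fj//; apply/mapP; exists (nat_of_ord j) => //.
    by rewrite mem_iota/= add0n (leq_trans (ltn_ord j)).
  rewrite mulr0 addr0 gtr0_norm ?invr_gt0//.
  by rewrite ltf_pV2 ?posrE// ltr_nat ltnS ltnNge kM.
(* The points x_1, ..., x_n all belong to the support of [w (n, m)]. *)
have support_large s q : supported_by s (w q) -> (q.1 <= size s)%N.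
  move=> s0.
  rewrite -(size_iota 0 q.1) -(size_map (fun j => x j.+1)).
  apply: uniq_leq_size.
    by rewrite map_inj_uniq ?iota_uniq// => j k /x_inj[].
  move=> y /mapP[j]; rewrite mem_iota add0n => /= jq ->{y}.
  apply: contraT => xjs.
  have [|f [f_cont fj f0]] := separating_function d_metric (x := x j.+1)
      (s := s ++ [seq x l | l <- iota 0 q.1.+1 & l != j.+1]).
    rewrite mem_cat negb_or xjs andTb; apply/mapP => -[l].
    by rewrite mem_filter => /andP[/eqP lj _ /x_inj/esym].
  have [g [_ gE]] := extend_functional V_free f_cont.
  have fl l : (l <= q.1)%N -> l != j.+1 -> f (x l) = 0.
    move=> lq lj; apply: f0; rewrite mem_cat; apply/orP; right.
    by apply/map_f; rewrite mem_filter lj mem_iota.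
  have : g (w q) = 0 by apply: s0 => y ys; rewrite gE f0// mem_cat ys.
  rewrite gw gE fl// mulr0 add0r (bigD1 (Ordinal jq))//= gE fj big1 => [|l lj].
    by move=> /eqP; rewrite addr0 mulr1 gt_eqF// invr_gt0.
  by rewrite gE fl// eqSS; exact: lj.
have v_closed : closed (range v).
  apply: stagewise_closed => n; have [M MP] := stage_support n.
  apply: (iffLR accessible_finite_set_closed (hausdorff_accessible V_T2)).
  apply: sub_finite_set (finite_image v (small_support M)) => _ [[k _ <-] nk].
  exists k => //=; move: nk; rewrite -pv => /MP[s sM /support_large].
  by move=> /leq_trans; apply.
have [k _ vk0] : range v 0.
  apply: v_closed => U /v0[K _ /(_ K (leqnn K)) UK].
  by exists (v K); split => //; exists K.
(* 0 is not in the range: take the functional equal to 1 on all [i x]. *)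
have [g [_ gE]] := extend_functional V_free (fun=> cvg_cst (1 : R^o)).
have : 0 < g (w (p k)).
  rewrite gw gE mulr1 ltr_wpDr ?invr_gt0// mulr_ge0 ?invr_ge0//.
  by rewrite sumr_ge0// => j _; rewrite gE.
by rewrite pv vk0 linear0 ltxx.
Qed.

End k_omega_free_tvs.

(** * Sequential spaces and k_omega-spaces are k-spaces *)

Lemma compact_cvg_sequence (Z : topologicalType) (u : nat -> Z) (z : Z) :
  u @ \oo --> z -> compact (range u `|` [set z]).
Proof.
move=> uz F FF FK.
have [Fz|] := pselect (cluster F z); first by exists z; split => //; right.
move=> /existsNP[A /existsNP[W /not_implyP[FA /not_implyP[zW AW]]]].
have [N _ NW] := uz _ zW.
have FN : F (u @` `I_N).
  apply: filterS (filterI FA FK) => y [Ay [[n _ uy]|yz]]; last first.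
    by case: AW; exists y; split => //; rewrite yz; exact: nbhs_singleton zW.
  exists n => //=; rewrite ltnNge; apply/negP => Nn; apply: AW.
  by exists y; split => //; rewrite -uy; exact: NW.
have [y [[n _ uy] Fy]] := finite_compact (finite_image u (finite_II N)) FF FN.
by exists y; split => //; left; exists n.
Qed.

Lemma sequential_k_space (Z : topologicalType) :
  sequential_space Z -> k_space Z.
Proof.
move=> Z_seq A A_k; apply: Z_seq => u z Au uz.
have /A_k/closed_subspaceP[B B_closed BA] := compact_cvg_sequence uz.
suff [[]] : (A `&` (range u `|` [set z]) `&` (range u `|` [set z])) z by [].
rewrite -BA; split; last by right.
apply: B_closed => W /uz[N _ /(_ N (leqnn N)) WN].
exists (u N); split => //.
suff [] : (B `&` (range u `|` [set z])) (u N) by [].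
by rewrite BA; split; [split|]; [exact: Au|left; exists N|left; exists N].
Qed.

Lemma k_omega_k_space (Z : topologicalType) : k_omega_space Z -> k_space Z.
Proof.
move=> [C [_ C_cpt _ C_open]] A A_k; rewrite -openC; apply/C_open => n.
have /closed_subspaceP[B B_closed BA] := A_k _ (C_cpt n).
apply/open_subspaceP; exists (~` B); first exact: closed_openC.
rewrite -setIA setIid; apply/seteqP; split => z [nz Cz]; split => // Hz.
  suff [] : (B `&` C n) z by [].
  by rewrite BA.
suff [[]] : (A `&` C n `&` C n) z by [].
by rewrite -BA.
Qed.

(** * The equivalence *)

Unset Implicit Arguments.

Theorem theorem4p26 (R : realType) (X : topologicalType)
    (V : topologicalLmodType R) (i : X -> V)
    (X_metrizable : metrizable R X) (X_infinite : infinite_set [set: X])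
    (V_free : is_free_tvs i) :
  [<-> locally_compact [set: X] /\ separable X;
       ~ frechet_urysohn V /\ sequential_space V;
       k_space V;
       k_omega_space V].
Proof.
have [d d_metric] := X_metrizable.
have [x0 _] := infinite_setN0 X_infinite.
have k_i : k_space V -> locally_compact [set: X] /\ separable X.
  move=> V_k; split.
    exact: k_space_free_locally_compact d_metric V_free V_k.
  exact: k_space_free_separable d_metric V_free V_k.
have exhaust : locally_compact [set: X] /\ separable X -> _ :=
  fun H => compact_exhaustion d_metric x0 H.1 H.2.
tfae.
- move=> /exhaust[C [C_cpt C_x0 C_nbhs]]; split.
    exact: (free_not_frechet_urysohn d_metric V_free C_x0 C_cpt C_nbhs).
  exact: (free_sequential d_metric V_free C_x0 C_cpt C_nbhs).
- by move=> [_ /sequential_k_space].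
- move=> /k_i/exhaust[C [C_cpt C_x0 C_nbhs]].
  exact: (free_k_omega V_free C_x0 C_cpt C_nbhs).
- by move=> /k_omega_k_space/k_i.
Qed.
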